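(* For any $d$-tuple $\boldsymbol T=(T_1,\ldots,T_d)$ of commuting bounded operators on a complex separable Hilbert space $\mathcal H$, $$\mathrm{dEt}\big([\![\boldsymbol T^*,\boldsymbol T]\!]\big)=\mathrm{GC}(\boldsymbol T^*,\boldsymbol T).$$
   Context: $[A,B]:=AB-BA$, and $\mathfrak S_n$ is the permutation group on $n$ symbols. For a $d\times d$ block operator $\boldsymbol B=(B_{ij})$ with $B_{ij}$ bounded operators on $\mathcal H$, its determinant is the operator on $\mathcal H$ $$\mathrm{dEt}(\boldsymbol B):=\sum_{\sigma,\tau\in\mathfrak S_d}\mathrm{Sgn}(\sigma)\,B_{\tau(1),\sigma(\tau(1))}B_{\tau(2),\sigma(\tau(2))}\cdots B_{\tau(d),\sigma(\tau(d))}.$$ For a commuting $d$-tuple $\boldsymbol T$, $[\![\boldsymbol T^*,\boldsymbol T]\!]$ is the $d\times d$ block operator with $(i,j)$ entry $B_{ij}=[T_j^*,T_i]$. The standard polynomial is $S_h(x_1,\ldots,x_h):=\sum_{\sigma\in\mathfrak S_h}\mathrm{Sgn}(\sigma)x_{\sigma(1)}\cdots x_{\sigma(h)}$ in non-commuting variables. The generalized commutator is $\mathrm{GC}(\boldsymbol T^*,\boldsymbol T):=S_{2d}(A_1,A_2,\ldots,A_{2d-1},A_{2d})$ with $A_1=T_1^*,\ A_2=T_1,\ \ldots,\ A_{2d-1}=T_d^*,\ A_{2d}=T_d$. *)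

(* Defs.v *)
From HB Require Import structures.
From mathcomp Require Import all_boot all_order all_algebra all_fingroup.
From mathcomp Require Import sesquilinear complex.
From mathcomp Require Import all_classical all_reals all_analysis.

Set Implicit Arguments.
Unset Strict Implicit.
Unset Printing Implicit Defensive.

Import Order.TTheory GRing.Theory Num.Theory.
Local Open Scope classical_set_scope.
Local Open Scope ring_scope.

(* [{dot H for conjC}] is linear in its first argument, conjugate-linear in
   its second argument, and positive definite. *)
HB.mixin Record CompleteNormedModule_isHilbert (R : realType) H
    & CompleteNormedModule R[i] H := {
  inner : {dot H for @Num.conj R[i]};
  sqr_norm_inner : forall x : H, `|x| ^+ 2 = inner x x
}.

#[short(type="hilbertType")]
HB.structure Definition Hilbert (R : realType) :=
  {H of CompleteNormedModule R[i] H & CompleteNormedModule_isHilbert R H}.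

Definition separable (T : topologicalType) : Prop :=
  exists2 D : set T, countable D & dense D.

Section BoundedOperator.
Context {R : realType} {H : hilbertType R}.

Definition is_bounded_op : {pred H -> H} := fun f =>
  `[< linear f /\ exists M : R[i], forall x : H, `|f x| <= M * `|x| >].

Lemma is_bounded_op_zmod_closed : zmod_closed is_bounded_op.
Proof.
split=> [|f g].
  apply/asboolP; split=> [a x y|]; first by rewrite /= scaler0 addr0.
  by exists 0 => x; rewrite normr0 mul0r.
move=> /asboolP[lf [M fM]] /asboolP[lg [N gN]]; apply/asboolP; split.
  move=> a x y; rewrite !fctE lf lg scalerDr scalerN opprD.
  by rewrite addrACA.
exists (M + N) => x; rewrite !fctE mulrDl.
by rewrite (le_trans (ler_normB _ _))// lerD.
Qed.

HB.instance Definition _ :=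
  GRing.isZmodClosed.Build (H -> H) is_bounded_op is_bounded_op_zmod_closed.

Lemma id_bounded_op : (idfun : H -> H) \in is_bounded_op.
Proof.
by apply/asboolP; split => //; exists 1 => x; rewrite mul1r.
Qed.

Lemma comp_bounded_op (f g : H -> H) : f \in is_bounded_op ->
  g \in is_bounded_op -> f \o g \in is_bounded_op.
Proof.
move=> /asboolP[lf [M fM]] /asboolP[lg [N gN]]; apply/asboolP; split.
  by move=> a x y; rewrite /= lg lf.
exists (`|M| * N) => x /=.
have fM' y : `|f y| <= `|M| * `|y|.
  rewrite -[`|y| in leRHS]normr_id -normrM ger0_norm//.
  exact: le_trans (fM y).
by rewrite (le_trans (fM' _))// -mulrA ler_wpM2l.
Qed.

End BoundedOperator.

Record bop (R : realType) (H : hilbertType R) := Bop {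
  bop_fun :> H -> H;
  bop_funP : bop_fun \in is_bounded_op }.

Section BoundedOperatorRing.
Context {R : realType} {H : hilbertType R}.

HB.instance Definition _ := [isSub for @bop_fun R H].
HB.instance Definition _ := [Choice of bop H by <:].
HB.instance Definition _ := [SubChoice_isSubZmodule of bop H by <:].

Lemma bop_ext (S T : bop H) : S =1 T -> S = T.
Proof. by move=> ST; apply/val_inj/funext. Qed.

HB.instance Definition _ (T : bop H) := GRing.isLinear.Build _ _ _ _ (T : H -> H)
  (let: conj lT _ := asboolP _ (bop_funP T) in lT).

Definition bop_one : bop H := Bop id_bounded_op.
Definition bop_mul (S T : bop H) : bop H :=
  Bop (comp_bounded_op (bop_funP S) (bop_funP T)).

Let mulA : associative bop_mul. Proof. by move=> S T U; exact: bop_ext. Qed.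
Let mul1 : left_id bop_one bop_mul. Proof. by move=> T; exact: bop_ext. Qed.
Let mulr1 : right_id bop_one bop_mul. Proof. by move=> T; exact: bop_ext. Qed.
Let mulDl : left_distributive bop_mul +%R.
Proof. by move=> S T U; exact: bop_ext. Qed.
Let mulDr : right_distributive bop_mul +%R.
Proof. by move=> S T U; apply: bop_ext => x; exact: raddfD. Qed.

HB.instance Definition _ := GRing.Zmodule_isPzRing.Build (bop H)
  mulA mul1 mulr1 mulDl mulDr.

(* By the Riesz representation theorem every bounded operator has exactly one
   adjoint, so the default value [0] is never taken. *)
Definition adjoint_of (T S : bop H) : Prop :=
  forall x y : H, inner (T x) y = inner x (S y).

Definition adj (T : bop H) : bop H := xget 0 [set S | adjoint_of T S].

Lemma adjoint_of_unique (T S S' : bop H) :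
  adjoint_of T S -> adjoint_of T S' -> S = S'.
Proof.
move=> TS TS'; apply: bop_ext => y; apply/eqP; rewrite -subr_eq0.
by rewrite -(dnorm_eq0 inner) linearB /= -TS -TS' subrr.
Qed.

Lemma adjE (T S : bop H) : adjoint_of T S -> adj T = S.
Proof.
by move=> TS; apply: xget_unique => // S' TS'; exact: adjoint_of_unique TS' TS.
Qed.

End BoundedOperatorRing.

Section NonCommutative.
Context {A : pzRingType}.

Definition commutator (a b : A) : A := a * b - b * a.

(* Non-commutative products over ['I_d] are taken left to right in increasing
   order of the index. *)
Definition dEt d (B : 'M[A]_d) : A :=
  \sum_(s : 'S_d) \sum_(t : 'S_d)
    (-1) ^+ s * \prod_(k < d) B (t k) (s (t k)).

Definition std_poly h (x : 'I_h -> A) : A :=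
  \sum_(s : 'S_h) (-1) ^+ s * \prod_(k < h) x (s k).

End NonCommutative.

Definition half_ord d (k : 'I_d.*2) : 'I_d :=
  Ordinal (etrans (ltn_half_double k d) (ltn_ord k)).

Section CommutatorsOfTuples.
Context {R : realType} {H : hilbertType R} {d : nat}.
Implicit Type T : 'I_d -> bop H.

Definition block_commutator T : 'M[bop H]_d :=
  \matrix_(i, j) commutator (adj (T j)) (T i).

(* The sequence T_0^*, T_0, T_1^*, T_1, ..., indexed from 0. *)
Definition adj_interleave T (k : 'I_d.*2) : bop H :=
  if odd k then T (half_ord k) else adj (T (half_ord k)).

Definition gen_commutator T : bop H := std_poly (adj_interleave T).

End CommutatorsOfTuples.

(* Main.v *)
From mathcomp Require Import all_fingroup.
Require Import Defs.
From mathcomp Require Import all_boot all_order all_algebra.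
From mathcomp Require Import all_classical all_reals all_analysis.

Import GRing.Theory.
Local Open Scope ring_scope.

(** The identity is purely ring-theoretic: the [T i] commute with each other,
    and so do their adjoints.

    In the standard polynomial of [x_0, ..., x_(2d-1)], group the factors of
    each monomial into the consecutive pairs of positions [2k], [2k+1].
    Exchanging the two entries of one pair flips the sign of the permutation
    and leaves the other factors alone, so the two monomials together produce
    a commutator. Keeping one permutation out of each such orbit, namely the
    one whose pairs are all sorted for a chosen tournament [r] on the indices,
    turns the standard polynomial into a signed sum of products of [d]
    commutators ([std_poly_commutators]).

    Choose [r] so that the even indices (the adjoints) precede the odd ones
    (the operators). A commutator of two entries of equal parity vanishes, so
    only the permutations [s] with [s (2k)] even and [s (2k+1)] odd for every
    [k] survive. Such an [s] is the same as a pair [(p, q)] of permutations of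
    the [d] indices, acting on the even and on the odd slots, and its sign is
    the product of the signs of [p] and [q] ([alternating_merge],
    [odd_merge_perm]). The outcome is the sum over [(p, q)] of
    [Sgn p * Sgn q * \prod_k [T_(p k)^*, T_(q k)]] ([std_poly_interleave]),
    which is the determinant after the substitution [p = sigma o tau],
    [q = tau] ([dEtE]). *)

(** * Extending a permutation along an injection *)

Section ExtendPerm.
Context {T T' : finType} {f : T -> T'} (injf : injective f).

Definition extend_fun (p : T -> T) (y : T') : T' :=
  if [pick x | f x == y] is Some x then f (p x) else y.

Lemma extend_fun_in p x : extend_fun p (f x) = f (p x).
Proof.
rewrite /extend_fun; case: pickP => [x' /eqP/injf -> //|/(_ x)].
by rewrite eqxx.
Qed.

Lemma extend_fun_out p y : (forall x, f x != y) -> extend_fun p y = y.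
Proof.
by rewrite /extend_fun => fy; case: pickP => // x; rewrite (negbTE (fy x)).
Qed.

Lemma extend_funP y : (exists x, y = f x) \/ (forall x, f x != y).
Proof.
case: (pickP (fun x => f x == y)) => [x /eqP <-|fy]; first by left; exists x.
by right=> x; rewrite fy.
Qed.

Lemma extend_fun_inj (p : {perm T}) : injective (extend_fun p).
Proof.
apply: (can_inj (g := extend_fun (p^-1)%g)) => y.
have [[x ->]|fy] := extend_funP y.
  by rewrite !extend_fun_in permK.
by rewrite !extend_fun_out.
Qed.

Definition extend_perm (p : {perm T}) : {perm T'} := perm (@extend_fun_inj p).

Lemma extend_permE p x : extend_perm p (f x) = f (p x).
Proof. by rewrite permE extend_fun_in. Qed.

Lemma extend_perm_out p y : (forall x, f x != y) -> extend_perm p y = y.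
Proof. by move=> fy; rewrite permE extend_fun_out. Qed.

Lemma extend_perm1 : extend_perm 1%g = 1%g.
Proof.
apply/perm.permP => y; have [[x ->]|fy] := extend_funP y.
  by rewrite extend_permE !perm1.
by rewrite extend_perm_out// perm1.
Qed.

Lemma extend_permM p q :
  extend_perm (p * q)%g = (extend_perm p * extend_perm q)%g.
Proof.
apply/perm.permP => y; have [[x ->]|fy] := extend_funP y.
  by rewrite permM !extend_permE permM.
by rewrite permM !extend_perm_out.
Qed.

Lemma extend_tperm a b : extend_perm (tperm a b) = tperm (f a) (f b).
Proof.
apply/perm.permP => y; have [[x ->]|fy] := extend_funP y.
  by rewrite extend_permE -inj_tperm.
by rewrite extend_perm_out// tpermD.
Qed.

(** Extension is multiplicative and sends transpositions to transpositions,
    so a factorization into transpositions keeps its length. *)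
Lemma odd_extend_perm p : odd_perm (extend_perm p) = odd_perm p.
Proof.
have [ts -> tsP] := prod_tpermP p; elim: ts tsP => [|[a b] ts IHts] /=.
  by rewrite !big_nil extend_perm1 !odd_perm1.
case/andP=> _ /IHts{}IHts; rewrite !big_cons extend_permM !odd_permM IHts.
by rewrite extend_tperm !odd_tperm (inj_eq injf).
Qed.

End ExtendPerm.

(** * Permutations that keep the parity of every position *)

Section Positions.
Context {d : nat}.

Fact even_pos_subproof (k : 'I_d) : (k.*2 < d.*2)%N.
Proof. by rewrite ltn_double. Qed.
Fact odd_pos_subproof (k : 'I_d) : (k.*2.+1 < d.*2)%N.
Proof. by rewrite ltn_Sdouble. Qed.

Definition even_pos (k : 'I_d) : 'I_d.*2 := Ordinal (even_pos_subproof k).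
Definition odd_pos (k : 'I_d) : 'I_d.*2 := Ordinal (odd_pos_subproof k).

Lemma half_even_pos k : half_ord (even_pos k) = k.
Proof. by apply: val_inj; rewrite /= doubleK. Qed.

Lemma half_odd_pos k : half_ord (odd_pos k) = k.
Proof. by apply: val_inj; rewrite /= uphalf_double. Qed.

Lemma odd_even_pos (k : 'I_d) : odd (even_pos k) = false.
Proof. by rewrite /= odd_double. Qed.

Lemma odd_odd_pos (k : 'I_d) : odd (odd_pos k) = true.
Proof. by rewrite /= odd_double. Qed.

Lemma even_pos_half (i : 'I_d.*2) : ~~ odd i -> even_pos (half_ord i) = i.
Proof.
by move=> oi; apply: val_inj; rewrite /= -[RHS]odd_double_half (negbTE oi).
Qed.

Lemma odd_pos_half (i : 'I_d.*2) : odd i -> odd_pos (half_ord i) = i.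
Proof. by move=> oi; apply: val_inj; rewrite /= -[RHS]odd_double_half oi. Qed.

Lemma even_pos_inj : injective even_pos.
Proof. exact: can_inj half_even_pos. Qed.

Lemma odd_pos_inj : injective odd_pos.
Proof. exact: can_inj half_odd_pos. Qed.

Lemma even_odd_pos j k : even_pos j != odd_pos k.
Proof.
by apply/eqP => /(congr1 (fun i : 'I_d.*2 => odd i));
  rewrite odd_even_pos odd_odd_pos.
Qed.

Definition merge_perm (p q : 'S_d) : 'S_d.*2 :=
  (extend_perm even_pos_inj p * extend_perm odd_pos_inj q)%g.

Lemma merge_perm_even p q k : merge_perm p q (even_pos k) = even_pos (p k).
Proof.
rewrite permM extend_permE (extend_perm_out odd_pos_inj)// => j.
by rewrite eq_sym even_odd_pos.
Qed.

Lemma merge_perm_odd p q k : merge_perm p q (odd_pos k) = odd_pos (q k).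
Proof.
rewrite permM (extend_perm_out even_pos_inj) ?extend_permE// => j.
by rewrite even_odd_pos.
Qed.

Lemma odd_merge_perm p q :
  odd_perm (merge_perm p q) = odd_perm p (+) odd_perm q.
Proof. by rewrite odd_permM !odd_extend_perm. Qed.

Definition alternating (s : 'S_d.*2) : bool :=
  [forall k, ~~ odd (s (even_pos k)) && odd (s (odd_pos k))].

Lemma merge_perm_inj : injective (fun u : 'S_d * 'S_d => merge_perm u.1 u.2).
Proof.
move=> [p q] [p' q'] /= eqm; congr pair; apply/perm.permP => k.
  by apply: even_pos_inj; rewrite -!(merge_perm_even _ q) eqm !merge_perm_even.
by apply: odd_pos_inj; rewrite -!(merge_perm_odd p) eqm !merge_perm_odd.
Qed.

(** With [merge_perm_inj], this parametrizes the permutations that survive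
    in the standard polynomial by pairs of permutations of the [d] indices. *)
Lemma alternating_merge s :
  alternating s =
  (s \in [set merge_perm u.1 u.2 | u in [set: 'S_d * 'S_d]]%SET).
Proof.
apply/idP/imsetP => [/forallP alt|[[p q] _ ->]]; last first.
  apply/forallP => k.
  by rewrite merge_perm_even merge_perm_odd odd_even_pos odd_odd_pos.
pose f k := half_ord (s (even_pos k)); pose g k := half_ord (s (odd_pos k)).
have fE k : even_pos (f k) = s (even_pos k).
  by rewrite even_pos_half//; have /andP[] := alt k.
have gE k : odd_pos (g k) = s (odd_pos k).
  by rewrite odd_pos_half//; have /andP[] := alt k.
have injf : injective f.
  by move=> j k /(congr1 even_pos); rewrite !fE => /perm_inj/even_pos_inj.
have injg : injective g.
  by move=> j k /(congr1 odd_pos); rewrite !gE => /perm_inj/odd_pos_inj.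
exists (perm injf, perm injg) => //; apply/perm.permP => i /=.
have [oi|oi] := boolP (odd i).
  by rewrite -(odd_pos_half i oi) merge_perm_odd permE gE.
by rewrite -(even_pos_half i oi) merge_perm_even permE fE.
Qed.

End Positions.

(** * The standard polynomial as a sum of products of commutators *)

Section StandardPolynomial.
Context {A : pzRingType}.

Lemma prod_ord_double d (F : 'I_d.*2 -> A) :
  \prod_k F k = \prod_(k < d) (F (even_pos k) * F (odd_pos k)).
Proof.
elim: d F => [|d IHd] F; first by rewrite !big_ord0.
rewrite !(big_ord_recl d.*2.+1) (big_ord_recl d.*2) (big_ord_recl d) mulrA IHd.
by congr (F _ * F _ * _); last (apply: eq_bigr => k _; congr (F _ * F _));
  apply: val_inj.
Qed.

(** Additivity of an ordered product in its [j]-th factor, phrased with three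
    families to avoid cutting a noncommutative product at [j]. *)
Lemma prod_ord_subr d (j : 'I_d) (F G K : 'I_d -> A) :
    F j = G j - K j -> (forall k, k != j -> F k = G k) ->
    (forall k, k != j -> F k = K k) ->
  \prod_k F k = \prod_k G k - \prod_k K k.
Proof.
elim: d j F G K => [[]//|d IHd] j F G K Fj FG FK; rewrite !big_ord_recl.
have [j0|] := eqVneq j ord0.
  have rest L : (forall k, k != j -> F k = L k) ->
      \prod_(i < d) L (lift ord0 i) = \prod_(i < d) F (lift ord0 i).
    by move=> FL; apply: eq_bigr => i _; rewrite FL// j0.
  by rewrite (rest _ FG) (rest _ FK) -mulrBl -j0 Fj.
case: (unliftP ord0 j) => [j' jE|-> /eqP//] j0.
rewrite -FG 1?eq_sym// -FK 1?eq_sym// -mulrBr; congr (_ * _).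
apply: (IHd j'); rewrite -?jE// => k kj; [apply: FG|apply: FK];
  by rewrite jE (inj_eq lift_inj).
Qed.

(** The case [0 = 0 - 0] of additivity. *)
Lemma prod_ord_eq0 d (j : 'I_d) (F : 'I_d -> A) : F j = 0 -> \prod_k F k = 0.
Proof.
by move=> Fj; rewrite (@prod_ord_subr _ j F F F) ?subrr.
Qed.

(** The tournament [r] selects one permutation from each orbit under the
    exchanges of the entries at positions [2k] and [2k+1]; the signed monomials
    of an orbit add up to the expansion of a product of commutators. The orbits
    are collapsed one pair of positions at a time. *)
Lemma std_poly_commutators d (r : rel 'I_d.*2) (x : 'I_d.*2 -> A) :
    (forall i j, i != j -> r i j = ~~ r j i) ->
  std_poly x =
    \sum_(s : 'S_d.*2 | [forall k, r (s (even_pos k)) (s (odd_pos k))])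
      (-1) ^+ s * \prod_k commutator (x (s (even_pos k))) (x (s (odd_pos k))).
Proof.
move=> tour.
(* After [j] steps the first [j] pairs are sorted and already carry a
   commutator, while the others still carry a plain product. *)
pose Q j (s : 'S_d.*2) :=
  [forall k : 'I_d, (k < j)%N ==> r (s (even_pos k)) (s (odd_pos k))].
pose F j (s : 'S_d.*2) (k : 'I_d) : A :=
  let u := x (s (even_pos k)) in let v := x (s (odd_pos k)) in
  if (k < j)%N then commutator u v else u * v.
suff S j : (j <= d)%N ->
    std_poly x = \sum_(s | Q j s) (-1) ^+ s * \prod_k F j s k.
  rewrite (S d (leqnn d)); apply: eq_big => s.
    by apply: eq_forallb => k; rewrite ltn_ord.
  by move=> _; congr (_ * _); apply: eq_bigr => k _; rewrite /F ltn_ord.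
elim: j => [_|j IHj jd].
  rewrite /std_poly; apply: eq_big => s; first by apply/esym/forallP.
  by rewrite prod_ord_double.
rewrite (IHj (ltnW jd)) {IHj}; pose J := Ordinal jd.
pose t := tperm (even_pos J) (odd_pos J).
have tL s : (t * s)%g (even_pos J) = s (odd_pos J) by rewrite permM tpermL.
have tR s : (t * s)%g (odd_pos J) = s (even_pos J) by rewrite permM tpermR.
have tDe s k : k != J -> (t * s)%g (even_pos k) = s (even_pos k).
  move=> kJ; rewrite permM tpermD// ?(inj_eq even_pos_inj) 1?eq_sym//.
  exact: even_odd_pos.
have tDo s k : k != J -> (t * s)%g (odd_pos k) = s (odd_pos k).
  move=> kJ; rewrite permM tpermD// ?(inj_eq odd_pos_inj) 1?eq_sym//.
  by rewrite eq_sym even_odd_pos.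
have Qt s : Q j (t * s)%g = Q j s.
  apply: eq_forallb => k; case: (ltnP k j) => //= kj.
  have kJ : k != J by rewrite -val_eqE /= (ltn_eqF kj).
  by rewrite tDe ?tDo.
have QS s : Q j.+1 s = Q j s && r (s (even_pos J)) (s (odd_pos J)).
  apply/forallP/andP => [Qs|[/forallP Qs rs] k].
    split; last exact: (implyP (Qs J)).
    apply/forallP => k; apply/implyP => kj.
    by apply: (implyP (Qs k)); apply: ltnW.
  apply/implyP; rewrite ltnS leq_eqVlt => /orP[/eqP kj|]; last exact/implyP.
  by have -> : k = J by exact: val_inj.
(* The permutations whose [J]-th pair is not sorted are matched with those
   whose [J]-th pair is sorted by the transposition [t]. *)
rewrite (bigID (fun s : 'S_d.*2 => r (s (even_pos J)) (s (odd_pos J)))) /=.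
rewrite [X in _ + X](reindex_inj (mulgI t)) /=.
rewrite (eq_bigl (Q j.+1)); last by move=> s; rewrite QS.
rewrite [X in _ + X](eq_bigl (Q j.+1)); last first.
  move=> s; rewrite QS Qt tL tR -tour//.
  by rewrite (inj_eq perm_inj) even_odd_pos.
rewrite -big_split /=; apply: eq_bigr => s _.
rewrite odd_permM odd_tperm even_odd_pos /= signrN mulNr -mulrBr.
congr (_ * _); apply/esym/(@prod_ord_subr _ J).
- by rewrite /F ltnS leqnn /= ltnn tL tR.
- move=> k kJ; rewrite /F.
  by rewrite ltnS leq_eqVlt (negbTE kJ : (k == j :> nat) = false).
- move=> k kJ; rewrite /F tDe// tDo//.
  by rewrite ltnS leq_eqVlt (negbTE kJ : (k == j :> nat) = false).
Qed.

(** The order within one parity class is immaterial, but some choice has to be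
    made for the relation to be a tournament. *)
Definition evens_first {d} (i j : 'I_d.*2) : bool :=
  if odd i == odd j then (i < j)%N else odd j.

Lemma evens_first_tournament d (i j : 'I_d.*2) :
  i != j -> evens_first i j = ~~ evens_first j i.
Proof.
rewrite /evens_first -val_eqE /= neq_ltn => /orP[] ij;
  by case: (odd i); case: (odd j); rewrite //= ?ij ltnNge (ltnW ij).
Qed.

(** With the even entries sorted before the odd ones, the commutators in a
    nonzero product all pair an even entry with an odd one. *)
Lemma std_poly_interleave d (x : 'I_d.*2 -> A) :
    (forall i j : 'I_d.*2, odd i = odd j -> x i * x j = x j * x i) ->
  std_poly x =
    \sum_(p : 'S_d) \sum_(q : 'S_d) (-1) ^+ (p (+) q) *
      \prod_k commutator (x (even_pos (p k))) (x (odd_pos (q k))).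
Proof.
move=> commx.
rewrite (std_poly_commutators d _ x (@evens_first_tournament d)).
rewrite (bigID alternating) /= [X in _ + X]big1 ?addr0; last first.
  (* A sorted pair that is not (even, odd) has two entries of equal parity. *)
  move=> s /andP[/forallP ef /forallPn[k nalt]].
  rewrite (@prod_ord_eq0 _ k) ?mulr0// /commutator commx ?subrr//.
  move: (ef k) nalt; rewrite /evens_first.
  by case: (odd _); case: (odd _).
rewrite (eq_bigl (fun s => s \in
    [set merge_perm u.1 u.2 | u in [set: 'S_d * 'S_d]]%SET)); last first.
  move=> s; rewrite -alternating_merge; apply: andb_idl => /forallP alt.
  apply/forallP => k; have /andP[] := alt k.
  by rewrite /evens_first => /negbTE -> ->.
rewrite big_imset /=; last by move=> u v _ _; exact: merge_perm_inj.
rewrite pair_big; apply: eq_big => [u|u _]; first by rewrite inE.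
rewrite odd_merge_perm; congr (_ * _); apply: eq_bigr => k _.
by rewrite merge_perm_even merge_perm_odd.
Qed.

(** Substituting [p = sigma o tau] for [sigma] decouples the row index from the
    column index and makes the sign symmetric in the two permutations. *)
Lemma dEtE d (B : 'M[A]_d) :
  dEt B = \sum_(p : 'S_d) \sum_(q : 'S_d) (-1) ^+ (p (+) q) *
    \prod_k B (q k) (p k).
Proof.
rewrite /dEt exchange_big [RHS]exchange_big; apply: eq_bigr => q _ /=.
rewrite [RHS](reindex_inj (mulgI q)); apply: eq_bigr => s _.
rewrite odd_permM addbC addKb; congr (_ * _).
by apply: eq_bigr => k _; rewrite permM.
Qed.

End StandardPolynomial.

(** * Operators on a Hilbert space *)

(** The product of adjoints, in either order, is an adjoint of [T * S = S * T],
    and adjoints are unique. If [S] or [T] has no adjoint, its default value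
    [0] makes both sides vanish. *)
Lemma adj_comm {R : realType} {H : hilbertType R} (S T : bop H) :
  S * T = T * S -> adj S * adj T = adj T * adj S.
Proof.
move=> ST; rewrite {1 4}/adj; case: xgetP => [S' _ S'P|_]; last first.
  by rewrite mul0r mulr0.
rewrite /adj; case: xgetP => [T' _ T'P|_]; last by rewrite mul0r mulr0.
apply: (@adjoint_of_unique _ _ (T * S)) => x y; last rewrite -ST.
  by rewrite /= T'P S'P.
by rewrite /= S'P T'P.
Qed.

Theorem theorem3p4 (R : realType) (H : hilbertType R) (sepH : separable H)
    (d : nat) (T : 'I_d -> bop H)
    (commT : forall i j : 'I_d, T i * T j = T j * T i) :
  dEt (block_commutator T) = gen_commutator T.
Proof.
rewrite dEtE /gen_commutator std_poly_interleave; last first.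
  move=> i j; rewrite /adj_interleave => ->; case: ifP => _; first exact: commT.
  exact/adj_comm/commT.
apply: eq_bigr => p _; apply: eq_bigr => q _; congr (_ * _).
apply: eq_bigr => k _; rewrite mxE /adj_interleave odd_even_pos odd_odd_pos.
by rewrite half_even_pos half_odd_pos.
Qed.
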